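(* Let $M\subset\mathbb{R}^n$ be closed and let $K\colon\mathbb{R}^n\rightrightarrows\mathbb{R}^m$ be a set-valued mapping with closed graph. Let $\bar z\in M\cap\operatorname{dom}K$ be a point at which $K$ is inner semicompact w.r.t. $\operatorname{dom}K$. Furthermore, let $K$ be inner calm* in the fuzzy sense w.r.t. $\operatorname{dom}K$ at $\bar z$, and let $K(\bar z)$ be a singleton. Assume that, for the uniquely determined $\bar\lambda\in K(\bar z)$, there is some $\kappa>0$ such that $$\widehat\partial\operatorname{dist}(\cdot,(M\times\mathbb{R}^m)\cap\operatorname{gph}K)(\bar z,\bar\lambda)\subset\kappa\bigl(\widehat\partial\operatorname{dist}(\cdot,M)(\bar z)\times\{0\}+\widehat\partial\operatorname{dist}(\cdot,\operatorname{gph}K)(\bar z,\bar\lambda)\bigr).$$ Then there is some (not necessarily the same) $\kappa'>0$ such that $$\widehat\partial\operatorname{dist}(\cdot,M\cap\operatorname{dom}K)(\bar z)\subset\kappa'\bigl(\widehat\partial\operatorname{dist}(\cdot,M)(\bar z)+\widehat\partial\operatorname{dist}(\cdot,\operatorname{dom}K)(\bar z)\bigr).$$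
   Context: $\operatorname{gph}K:=\{(z,\lambda)\mid\lambda\in K(z)\}$, $\operatorname{dom}K:=\{z\mid K(z)\neq\emptyset\}$; $\|\cdot\|$ is the Euclidean norm and $\operatorname{dist}(z,\Omega):=\inf_{z'\in\Omega}\|z'-z\|$. For $\Omega\subset\mathbb{R}^n$ locally closed around $\bar z\in\Omega$: the tangent cone $T_\Omega(\bar z)$ is the set of all $w$ for which there are $t_k\downarrow0$ (with $t_k>0$) and $w_k\to w$ with $\bar z+t_kw_k\in\Omega$ for all $k$; the regular normal cone is $\widehat N_\Omega(\bar z):=\{\zeta\mid\zeta^\top(z-\bar z)\le o(\|z-\bar z\|)\ \forall z\in\Omega\}$. Regular subdifferential of a lower semicontinuous $\upsilon\colon\mathbb{R}^n\to\mathbb{R}$: $\widehat\partial\upsilon(\bar z):=\{\zeta\mid(\zeta,-1)\in\widehat N_{\operatorname{epi}\upsilon}(\bar z,\upsilon(\bar z))\}$, where $\operatorname{epi}\upsilon:=\{(z,\alpha)\mid\alpha\ge\upsilon(z)\}$. $K$ is inner semicompact w.r.t. $\operatorname{dom}K$ at $\bar z\in\operatorname{dom}K$ if for each sequence $\{z_k\}\subset\operatorname{dom}K$ with $z_k\to\bar z$ there is a sequence $\{\lambda_k\}$ possessing a bounded subsequence such that $\lambda_k\in K(z_k)$ for all $k$. (This together with closedness of $\operatorname{gph}K$ makes $\operatorname{dom}K$ closed locally around $\bar z$.) $K$ is inner calm* in the fuzzy sense w.r.t. $\operatorname{dom}K$ at $\bar z\in\operatorname{dom}K$ if for each $d\in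 T_{\operatorname{dom}K}(\bar z)$ with $\|d\|=1$ there exist $\kappa_d>0$, $\tilde\lambda\in\mathbb{R}^m$, and sequences $t_k\downarrow0$ (with $t_k>0$), $d_k\to d$, $\lambda_k\to\tilde\lambda$ such that $\lambda_k\in K(\bar z+t_kd_k)$ and $\|\lambda_k-\tilde\lambda\|\le\kappa_dt_k\|d_k\|$ for all $k$. *)

(* Defs.v *)
From mathcomp Require Import all_boot all_order all_algebra.
From mathcomp Require Import all_classical all_reals all_analysis.

Set Implicit Arguments.
Unset Strict Implicit.
Unset Printing Implicit Defensive.

Import Order.TTheory GRing.Theory Num.Theory.
Import numFieldNormedType.Exports.

Local Open Scope classical_set_scope.
Local Open Scope ring_scope.

(* R^n is 'rV[R]_n, and R^n x R^m is 'rV[R]_(n + m), the pair (z, l) being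
   row_mx z l.  The library norm `|_| on 'rV[R]_n is the maximum norm: its
   topology is the Euclidean one, so it serves for closedness and convergence,
   but metric notions must use the Euclidean norm enorm. *)

Definition dotp (R : realType) (n : nat) (u v : 'rV[R]_n) : R :=
  \sum_(i < n) u 0 i * v 0 i.

Definition enorm (R : realType) (n : nat) (u : 'rV[R]_n) : R :=
  Num.sqrt (dotp u u).

(* inf set0 = 0, so dist is meaningful for nonempty A only. *)
Definition dist (R : realType) (n : nat) (A : set 'rV[R]_n) (z : 'rV[R]_n) : R :=
  inf [set enorm (z' - z) | z' in A].

Definition prodset (R : realType) (n m : nat)
    (A : set 'rV[R]_n) (B : set 'rV[R]_m) : set 'rV[R]_(n + m) :=
  [set p | A (lsubmx p) /\ B (rsubmx p)].

Definition addset (R : realType) (n : nat) (A B : set 'rV[R]_n) :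
    set 'rV[R]_n :=
  [set a + b | a in A & b in B].

Definition scaleset (R : realType) (n : nat) (c : R) (A : set 'rV[R]_n) :
    set 'rV[R]_n :=
  [set c *: a | a in A].

(* The convergence t_k -> 0 from above does not require t to be monotone. *)
Definition tangent_cone (R : realType) (n : nat)
    (A : set 'rV[R]_n) (z : 'rV[R]_n) : set 'rV[R]_n :=
  [set w | exists (t : nat -> R) (w_ : nat -> 'rV[R]_n),
    [/\ forall k, 0 < t k, t @ \oo --> (0 : R), w_ @ \oo --> w &
        forall k, A (z + t k *: w_ k)]].

Definition regular_normal_cone (R : realType) (n : nat)
    (A : set 'rV[R]_n) (z : 'rV[R]_n) : set 'rV[R]_n :=
  [set zeta | exists2 r : 'rV[R]_n -> R^o,
    r =o_ z (fun y => enorm (y - z) : R^o) &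
    forall y, A y -> dotp zeta (y - z) <= r y].

Definition epi (R : realType) (n : nat) (v : 'rV[R]_n -> R) :
    set 'rV[R]_(n + 1) :=
  [set p | v (lsubmx p) <= rsubmx p 0 0].

Definition regular_subdiff (R : realType) (n : nat)
    (v : 'rV[R]_n -> R) (z : 'rV[R]_n) : set 'rV[R]_n :=
  [set zeta | regular_normal_cone (epi v)
    (row_mx z (const_mx (v z))) (row_mx zeta (const_mx (-1)))].

Section SetValuedMaps.
Variables (R : realType) (n m : nat) (K : 'rV[R]_n -> set 'rV[R]_m).

Definition gph : set 'rV[R]_(n + m) := [set p | K (lsubmx p) (rsubmx p)].

Definition dom : set 'rV[R]_n := [set z | K z !=set0].

Definition inner_semicompact_dom (zb : 'rV[R]_n) : Prop :=
  forall z_ : nat -> 'rV[R]_n,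
    (forall k, dom (z_ k)) -> z_ @ \oo --> zb ->
    exists l_ : nat -> 'rV[R]_m,
      (forall k, K (z_ k) (l_ k)) /\
      exists (phi : nat -> nat) (C : R),
        increasing_seq phi /\ forall j, enorm (l_ (phi j)) <= C.

Definition fuzzy_inner_calm_star_dom (zb : 'rV[R]_n) : Prop :=
  forall d : 'rV[R]_n, tangent_cone dom zb d -> enorm d = 1 ->
    exists (kappa : R) (lt : 'rV[R]_m)
           (t : nat -> R) (d_ : nat -> 'rV[R]_n) (l_ : nat -> 'rV[R]_m),
      0 < kappa /\
      [/\ forall k, 0 < t k, t @ \oo --> (0 : R), d_ @ \oo --> d &
          l_ @ \oo --> lt] /\
      forall k, K (zb + t k *: d_ k) (l_ k) /\
                enorm (l_ k - lt) <= kappa * t k * enorm (d_ k).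

End SetValuedMaps.

(* Main.v *)
Require Import Defs.
From mathcomp Require Import all_boot all_order all_algebra.
From mathcomp Require Import all_classical all_reals all_analysis.
From mathcomp Require Import ring lra.
Import Order.TTheory GRing.Theory Num.Theory.
Import numFieldNormedType.Exports.
Local Open Scope classical_set_scope.
Local Open Scope ring_scope.

(** At a point of a set, the regular subdifferential of the distance to that set
is the part of the regular normal cone inside the closed unit ball
([regular_subdiff_dist]). So every inclusion in the statement is one between
regular normals of norm at most one.

Let [zeta] be such a normal to [M `&` dom K] at [zb]. The first components of
the points of the joint set of [(z, l)] with [z] in [M] and [l] in [K z] lie in
[M `&` dom K], so [(zeta, 0)] is a normal of the same norm to the joint set at
[(zb, lb)]. The assumed inclusion splits it as
[kappa * ((a, 0) + (b, c))] with [a] a subgradient of [dist M] and [(b, c)] one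
of [dist (gph K)]; the second component forces [c = 0]. It remains to see that
[b] is normal to [dom K] ([graph_normal_dom_normal]); its norm is at most one,
hence [zeta = kappa * (a + b)] is the desired splitting, with the same constant.

In finite dimension a vector in the polar of the tangent cone is a regular
normal ([polar_tangent_sub_regular_normal]), so it is enough to show that
[dotp b d <= 0] for each unit tangent direction [d] of [dom K]. Inner calmness
supplies points of [gph K] over [zb + t_k d_k] whose multipliers converge with an
error of order [t_k]. Their limit lies in [K zb] by closedness of the graph, so
it is [lb], and the normality of [(b, 0)] along these points, divided by [t_k],
gives the claim. *)

Set Implicit Arguments.
Unset Strict Implicit.

(** * The Euclidean norm and the topology of row vectors *)

Section EuclideanNorm.
Variables (R : realType) (n : nat).
Implicit Types (u v w : 'rV[R]_n) (c : R).

Lemma dotpC u v : dotp u v = dotp v u.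
Proof. by apply: eq_bigr => i _; rewrite mulrC. Qed.

Lemma dotpDl u v w : dotp (u + v) w = dotp u w + dotp v w.
Proof. by rewrite -big_split; apply: eq_bigr => i _; rewrite mxE mulrDl. Qed.

Lemma dotpZl c u v : dotp (c *: u) v = c * dotp u v.
Proof. by rewrite /dotp mulr_sumr; apply: eq_bigr => i _; rewrite mxE mulrA. Qed.

Lemma dotpDr u v w : dotp w (u + v) = dotp w u + dotp w v.
Proof. by rewrite dotpC dotpDl !(dotpC w). Qed.

Lemma dotpZr c u v : dotp v (c *: u) = c * dotp v u.
Proof. by rewrite dotpC dotpZl dotpC. Qed.

Lemma dotpNr u v : dotp v (- u) = - dotp v u.
Proof. by rewrite -scaleN1r dotpZr mulN1r. Qed.

Lemma dotp0r u : dotp u 0 = 0.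
Proof. by rewrite -(scale0r (0 : 'rV[R]_n)) dotpZr mul0r. Qed.

Lemma dotp0l u : dotp 0 u = 0.
Proof. by rewrite dotpC dotp0r. Qed.

Lemma dotp_ge0 u : 0 <= dotp u u.
Proof. by apply: sumr_ge0 => i _; rewrite -expr2 sqr_ge0. Qed.

Lemma enorm_ge0 u : 0 <= enorm u.
Proof. exact: sqrtr_ge0. Qed.

Lemma sqr_enorm u : enorm u ^+ 2 = dotp u u.
Proof. by rewrite sqr_sqrtr // dotp_ge0. Qed.

Lemma enormZ c u : enorm (c *: u) = `|c| * enorm u.
Proof.
by rewrite /enorm dotpZl dotpZr mulrA -expr2 sqrtrM ?sqr_ge0// sqrtr_sqr.
Qed.

Lemma enormN u : enorm (- u) = enorm u.
Proof. by rewrite -scaleN1r enormZ normrN1 mul1r. Qed.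

Lemma enorm0 : enorm (0 : 'rV[R]_n) = 0.
Proof. by rewrite -(scale0r (0 : 'rV[R]_n)) enormZ normr0 mul0r. Qed.

Lemma enormBC u v : enorm (u - v) = enorm (v - u).
Proof. by rewrite -enormN opprB. Qed.

Lemma abs_coord_le_enorm u i : `|u 0 i| <= enorm u.
Proof.
rewrite -sqrtr_sqr ler_wsqrtr// expr2 /dotp (bigD1 i)//= lerDl.
by apply: sumr_ge0 => j _; rewrite -expr2 sqr_ge0.
Qed.

Lemma norm_le_enorm u : `|u| <= enorm u.
Proof.
rewrite [`|u|]mx_normrE; apply: bigmax_le => [|[i j] _]; first exact: enorm_ge0.
by rewrite ord1 abs_coord_le_enorm.
Qed.

Lemma enorm_le_norm u : enorm u <= n.+1%:R * `|u|.
Proof.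
have coord_le i : `|u 0 i| <= `|u|.
  rewrite [leRHS]mx_normrE.
  exact: (le_bigmax _ (fun ij => `|u ij.1 ij.2|) (0, i)).
rewrite -(@ler_pXn2r _ 2)// ?nnegrE ?enorm_ge0 ?mulr_ge0// sqr_enorm exprMn.
apply: (@le_trans _ _ (n%:R * `|u| ^+ 2)); last first.
  rewrite ler_wpM2r ?sqr_ge0// -natrX ler_nat -mulnn.
  exact: leq_trans (leqnSn _) (leq_pmull _ _).
rewrite -[n in n%:R]card_ord -sum1_card natr_sum mulr_suml.
apply: ler_sum => i _; rewrite mul1r -expr2 -(real_normK (num_real (u 0 i))).
by rewrite ler_pXn2r// ?nnegrE.
Qed.

Lemma enorm_eq0 u : enorm u = 0 -> u = 0.
Proof.
by move=> u0; apply/eqP; rewrite -normr_le0 -u0 norm_le_enorm.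
Qed.

(** Cauchy-Schwarz: expand the square of [enorm v *: u - enorm u *: v]. *)
Lemma dotp_le_enorm u v : dotp u v <= enorm u * enorm v.
Proof.
have [/eqP u0|u0] := eqVneq (enorm u) 0.
  by move/eqP/enorm_eq0: u0 => ->; rewrite dotp0l enorm0 mul0r.
have [/eqP v0|v0] := eqVneq (enorm v) 0.
  by move/eqP/enorm_eq0: v0 => ->; rewrite dotp0r enorm0 mulr0.
have := dotp_ge0 (enorm v *: u - enorm u *: v).
rewrite -scaleNr !(dotpDl, dotpDr, dotpZl, dotpZr) (dotpC v u) -!sqr_enorm => h.
have uv_gt0 : 0 < enorm u * enorm v.
  by rewrite mulr_gt0// lt0r ?u0 ?v0 enorm_ge0.
rewrite -(ler_pM2l uv_gt0); nra.
Qed.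

Lemma ler_enormD u v : enorm (u + v) <= enorm u + enorm v.
Proof.
rewrite -(@ler_pXn2r _ 2)// ?nnegrE ?enorm_ge0 ?addr_ge0 ?enorm_ge0//.
rewrite sqr_enorm !(dotpDl, dotpDr) (dotpC v u) sqrrD !sqr_enorm.
by have := dotp_le_enorm u v; lra.
Qed.

Lemma ler_enormB u v w : enorm (u - w) <= enorm (u - v) + enorm (v - w).
Proof. by apply: le_trans (ler_enormD _ _); rewrite addrA subrK. Qed.

(** The topology is defined by the maximum norm; its equivalence with the
Euclidean norm is what lets topological hypotheses meet the metric notions. *)
Lemma nbhs_enormP (z : 'rV[R]_n) (P : set 'rV[R]_n) :
  nbhs z P <-> exists2 d : R, 0 < d & forall y, enorm (y - z) < d -> P y.
Proof.
split=> [/nbhs_ballP[d /= d0 dP]|[d d0 dP]].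
  exists d => // y yz; apply: dP; rewrite -ball_normE /= distrC.
  exact: le_lt_trans (norm_le_enorm _) yz.
apply/nbhs_ballP; exists (d / n.+1%:R); first by rewrite /= divr_gt0.
move=> y; rewrite -ball_normE /= distrC ltr_pdivlMr// mulrC => yz.
by apply: dP; exact: le_lt_trans (enorm_le_norm _) yz.
Qed.

Lemma near_enorm (z : 'rV[R]_n) (d : R) : 0 < d ->
  \forall y \near z, enorm (y - z) < d.
Proof. by move=> d0; apply/nbhs_enormP; exists d. Qed.

Lemma cvg_enormP (u_ : nat -> 'rV[R]_n) (z : 'rV[R]_n) :
  u_ @ \oo --> z <->
  forall e : R, 0 < e -> \forall k \near \oo, enorm (u_ k - z) < e.
Proof.
split=> [uz e e0|uz P /nbhs_enormP[e e0 eP]].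
  exact: uz _ (near_enorm z e0).
by near=> k; apply: eP; near: k; exact: uz.
Unshelve. all: by end_near. Qed.

Lemma enorm_continuous : continuous (@enorm R n).
Proof.
move=> z; apply/(@cvgrPdist_lt _ _ _ _ (nbhs_filter z)) => e e0; near=> y.
have yz : enorm (y - z) < e by near: y; exact: near_enorm.
apply: le_lt_trans yz; rewrite ler_norml; apply/andP; split.
  by have := ler_enormD (y - z) z; rewrite subrK; lra.
by have := ler_enormD (z - y) y; rewrite subrK enormBC; lra.
Unshelve. all: by end_near. Qed.

Lemma cvg_enorm (u_ : nat -> 'rV[R]_n) (z : 'rV[R]_n) :
  u_ @ \oo --> z -> enorm (u_ k) @[k --> \oo] --> enorm z.
Proof. by move=> uz; apply: cvg_comp uz (@enorm_continuous z). Qed.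

Lemma cvg_dotp (zeta : 'rV[R]_n) (u_ : nat -> 'rV[R]_n) (z : 'rV[R]_n) :
  u_ @ \oo --> z -> dotp zeta (u_ k) @[k --> \oo] --> dotp zeta z.
Proof.
move=> /cvg_enormP uz; apply/cvgrPdist_lt => e e0.
have a1 : 0 < enorm zeta + 1 by rewrite ltr_wpDl ?enorm_ge0.
near=> k; have : enorm (u_ k - z) < e / (enorm zeta + 1).
  by near: k; apply: uz; rewrite divr_gt0.
rewrite ltr_pdivlMr// -dotpNr -dotpDr => uk.
have b1 := dotp_le_enorm zeta (z - u_ k).
have b2 := dotp_le_enorm zeta (u_ k - z).
have uk0 := enorm_ge0 (u_ k - z); move: b1 b2.
rewrite -(opprB (u_ k)) enormN dotpNr normrN => b1 b2.
by rewrite ltr_norml; apply/andP; split; nra.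
Unshelve. all: by end_near. Qed.

Lemma compact_unit_sphere : compact [set u : 'rV[R]_n | enorm u = 1].
Proof.
apply: bounded_closed_compact.
  exists 1; split=> // M M1 u /= u1; apply: le_trans (norm_le_enorm _) _.
  by rewrite u1 ltW.
apply: (@preimage_closed _ _ (@enorm R n) [set 1]) => [u _|].
  exact: enorm_continuous.
exact: closed_eq.
Qed.

End EuclideanNorm.

Section Product.
Variables (R : realType) (n m : nat).
Implicit Types (u a : 'rV[R]_n) (v b : 'rV[R]_m).

Lemma dotp_row_mx u a v b :
  dotp (row_mx u v) (row_mx a b) = dotp u a + dotp v b.
Proof.
rewrite /dotp big_split_ord; congr (_ + _); apply: eq_bigr => i _.
  by rewrite !row_mxEl.
by rewrite !row_mxEr.
Qed.

Lemma enorm_row_mx0 u : enorm (row_mx u (0 : 'rV[R]_m)) = enorm u.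
Proof. by rewrite /enorm dotp_row_mx dotp0r addr0. Qed.

Lemma enorm_row_0mx v : enorm (row_mx (0 : 'rV[R]_n) v) = enorm v.
Proof. by rewrite /enorm dotp_row_mx dotp0r add0r. Qed.

Lemma enorm_row_mx_le u v : enorm (row_mx u v) <= enorm u + enorm v.
Proof.
rewrite -(enorm_row_mx0 u) -(enorm_row_0mx v).
by apply: le_trans (ler_enormD _ _); rewrite add_row_mx addr0 add0r.
Qed.

Lemma enorm_le_row_mx u v : enorm u <= enorm (row_mx u v).
Proof. by rewrite ler_wsqrtr// dotp_row_mx lerDl dotp_ge0. Qed.

Lemma sub_row_mx u a v b : row_mx u v - row_mx a b = row_mx (u - a) (v - b).
Proof. by rewrite opp_row_mx add_row_mx. Qed.

Lemma cvg_row_mx (u_ : nat -> 'rV[R]_n) (v_ : nat -> 'rV[R]_m) a b :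
  u_ @ \oo --> a -> v_ @ \oo --> b ->
  row_mx (u_ k) (v_ k) @[k --> \oo] --> row_mx a b.
Proof.
move=> /cvg_enormP ua /cvg_enormP vb; apply/cvg_enormP => e e0.
have e20 : 0 < e / 2 by rewrite divr_gt0.
near=> k; rewrite sub_row_mx; apply: le_lt_trans (enorm_row_mx_le _ _) _.
rewrite (splitr e) ltrD//; near: k; [exact: ua|exact: vb].
Unshelve. all: by end_near. Qed.

End Product.

(** * Regular normals and the distance function *)

Section RegularNormals.
Variables (R : realType) (n : nat).
Implicit Types (A : set 'rV[R]_n) (z zeta : 'rV[R]_n).

(** The remainder function of the definition exists as soon as the inequality
holds with every constant [e] near [z]; in this form no remainder has to be
exhibited or transported. *)
Lemma regular_normal_coneP A z zeta :
  regular_normal_cone A z zeta <->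
  forall e : R, 0 < e -> exists2 d : R, 0 < d &
    forall y, A y -> enorm (y - z) < d -> dotp zeta (y - z) <= e * enorm (y - z).
Proof.
split=> [[r /eqoP r_o rP] e e0|h].
  have /nbhs_enormP[d d0 dP] := r_o e e0.
  exists d => // y Ay /dP; rewrite [X in _ <= _ * X]ger0_norm ?enorm_ge0//.
  by apply: le_trans; apply: le_trans (ler_norm _); exact: rP.
(* the smallest nonnegative remainder *)
exists (fun y => if `[< A y >] then Num.max 0 (dotp zeta (y - z)) else 0);
    last by move=> y Ay; rewrite asboolT// le_max lexx orbT.
apply/eqoP => e e0; have [d d0 dP] := h e e0.
apply/nbhs_enormP; exists d => // y yd.
rewrite [X in _ <= _ * X]ger0_norm ?enorm_ge0//; case: asboolP => Ay.
  rewrite [X in X <= _]ger0_norm ?le_max ?lexx// ge_max dP// andbT.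
  by rewrite mulr_ge0 ?enorm_ge0 ?ltW.
by rewrite normr0 mulr_ge0 ?enorm_ge0 ?ltW.
Qed.

Lemma dist_has_lbound A z : has_lbound [set enorm (z' - z) | z' in A].
Proof. by exists 0 => _ [y _ <-]; exact: enorm_ge0. Qed.

Lemma dist_le A z y : A y -> dist A z <= enorm (y - z).
Proof. by move=> Ay; apply: ge_inf; [exact: dist_has_lbound|exists y]. Qed.

Lemma dist_ge0 A z : 0 <= dist A z.
Proof.
have [->|/set0P[y Ay]] := eqVneq A set0; first by rewrite /dist image_set0 inf0.
by apply: lb_le_inf => [|_ [x _ <-]]; [exists (enorm (y - z)), y|exact: enorm_ge0].
Qed.

Lemma dist_eq0 A z : A z -> dist A z = 0.
Proof.
move=> Az; apply/eqP; rewrite eq_le dist_ge0 andbT.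
by have := dist_le z Az; rewrite subrr enorm0.
Qed.

Lemma dist_adherent A z (e : R) : A !=set0 -> 0 < e ->
  exists2 y, A y & enorm (y - z) < dist A z + e.
Proof.
move=> [x Ax] e0.
have [|_ [y Ay <-] ye] := @inf_adherent R [set enorm (z' - z) | z' in A] e e0.
  by split; [exists (enorm (x - z)), x|exact: dist_has_lbound].
by exists y.
Qed.

End RegularNormals.

(** Moving from [z] along [zeta] raises [dist A] at rate at most [enorm zeta],
which bounds [enorm zeta] by [1]; on [A] itself the distance vanishes, so only
the normal inequality is left. Conversely, a normal inequality on [A] is carried
to a point [y] off [A] through an almost nearest point of [A], and there the
error [dotp zeta (y - y')] is at most [enorm (y - y')], almost [dist A y]. *)
Lemma regular_subdiff_dist (R : realType) (n : nat)
    (A : set 'rV[R]_n) (z : 'rV[R]_n) : A z ->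
  regular_subdiff (dist A) z =
  regular_normal_cone A z `&` [set zeta | enorm zeta <= 1].
Proof.
move=> Az; apply/seteqP; split=> zeta; rewrite /regular_subdiff /= dist_eq0//.
  move/regular_normal_coneP => h; split.
    apply/regular_normal_coneP => e e0; have [d d0 dP] := h e e0.
    exists d => // y Ay yd; have := dP (row_mx y (const_mx 0)).
    rewrite sub_row_mx subrr enorm_row_mx0 dotp_row_mx dotp0r addr0; apply => //.
    by rewrite /epi /= row_mxKl row_mxKr dist_eq0// mxE.
  rewrite leNgt; apply/negP => zeta1.
  have zeta0 : 0 < enorm zeta by apply: lt_trans zeta1.
  (* Dividing [dP] at [(z + t * zeta, t * enorm zeta)] by [t * enorm zeta] gives
     [enorm zeta - 1 <= 2 * e], since this point of the epigraph is within
     [2 * t * enorm zeta] of [(z, 0)]; the tolerance [e] below refutes that. The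
     step [t] makes the bound [2 * t * enorm zeta] equal to [d / 2]. *)
  have [|d d0 dP] := h ((enorm zeta - 1) / 4); first by lra.
  pose t := d / (4 * enorm zeta).
  have t0 : 0 < t by rewrite divr_gt0// mulr_gt0.
  have dt : d = 4 * (t * enorm zeta) by rewrite /t; field; rewrite gt_eqF.
  have tz0 : 0 < t * enorm zeta by rewrite mulr_gt0.
  have epi_p :
      epi (dist A) (row_mx (z + t *: zeta) (const_mx (t * enorm zeta))).
    rewrite /epi /= row_mxKl row_mxKr mxE; apply: le_trans (dist_le _ Az) _.
    by rewrite opprD addrA subrr sub0r enormN enormZ gtr0_norm.
  have := dP _ epi_p; rewrite sub_row_mx addrAC subrr add0r dotp_row_mx dotpZr.
  rewrite -sqr_enorm.
  have -> : const_mx (t * enorm zeta) - const_mx 0 =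
      (t * enorm zeta) *: const_mx 1 :> 'rV[R]_1.
    by apply/rowP => i; rewrite !mxE subr0 mulr1.
  have -> : dotp (const_mx (-1)) ((t * enorm zeta) *: const_mx 1 : 'rV[R]_1) =
      - (t * enorm zeta).
    by rewrite /dotp big_ord1 !mxE mulr1 mulN1r.
  have := enorm_row_mx_le (t *: zeta)
    ((t * enorm zeta) *: (const_mx 1 : 'rV[R]_1)).
  have -> : enorm ((t * enorm zeta) *: (const_mx 1 : 'rV[R]_1)) = t * enorm zeta.
    by rewrite enormZ /enorm /dotp big_ord1 !mxE mulr1 sqrtr1 mulr1 gtr0_norm.
  rewrite enormZ (gtr0_norm t0) => le2 main.
  have := main _; nra.
move=> [/regular_normal_coneP h zeta1]; apply/regular_normal_coneP => e e0.
(* The almost nearest point [y'] chosen below is within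
   [(2 + e1) * enorm (y - z)] of [z]. With [e1 <= 1] this is at most
   [3 * enorm (y - z)], and the errors add up to
   [(1 + 3) * e1 * enorm (y - z)]. *)
pose e1 := Num.min 1 (e / 4).
have e10 : 0 < e1 by rewrite lt_min ltr01 divr_gt0.
have e11 : e1 <= 1 by rewrite ge_min lexx.
have e1e : e1 <= e / 4 by rewrite ge_min lexx orbT.
have [d d0 dP] := h e1 e10.
exists (d / 3); first by rewrite divr_gt0.
move=> p; rewrite -(hsubmxK p) /epi /= row_mxKl row_mxKr.
set y := lsubmx p; set al := rsubmx p; rewrite sub_row_mx => dist_al pd.
have yp := enorm_le_row_mx (y - z) (al - const_mx 0).
apply: (@le_trans _ _ (e * enorm (y - z))); last by rewrite ler_wpM2l// ltW.
have -> : dotp (row_mx zeta (const_mx (-1))) (row_mx (y - z) (al - const_mx 0))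
    = dotp zeta (y - z) - al 0 0.
  by rewrite dotp_row_mx /dotp [X in _ + X]big_ord1 !mxE mulN1r subr0.
have [->|yz] := eqVneq y z.
  rewrite subrr dotp0r enorm0 mulr0 sub0r oppr_le0.
  exact: le_trans (dist_ge0 _ _) dist_al.
have yz0 : 0 < enorm (y - z).
  rewrite lt0r enorm_ge0 andbT; apply: contra_neq yz => /enorm_eq0/eqP.
  by rewrite subr_eq0 => /eqP.
have [||y' Ay' yy'] := @dist_adherent _ _ A y (e1 * enorm (y - z)).
- by exists z.
- by rewrite mulr_gt0.
have y'z : enorm (y' - z) <= 3 * enorm (y - z).
  have := ler_enormB y' y z; have := dist_le y Az.
  by rewrite (enormBC z y); nra.
have /dP : enorm (y' - z) < d by lra.
move=> /(_ Ay') normal_y'.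
have -> : dotp zeta (y - z) = dotp zeta (y - y') + dotp zeta (y' - z).
  by rewrite -dotpDr addrA subrK.
have cs : dotp zeta (y - y') <= enorm (y' - y).
  by apply: le_trans (dotp_le_enorm _ _) _; rewrite enormBC ler_piMl ?enorm_ge0.
have e1z := ler_wpM2r (ltW yz0) e1e.
have e1y' := ler_wpM2l (ltW e10) y'z.
have : dist A y <= al 0 0 := dist_al.
lra.
Qed.

(** * Normals to the domain of a set-valued map *)

(** If [zeta] is not normal, there are points of [A] arbitrarily close to [z]
that violate the inequality for some fixed [e]. Their unit directions from [z]
cluster, by compactness of the sphere, at a tangent direction [d], for which
[dotp zeta d >= e]. *)
Lemma polar_tangent_sub_regular_normal (R : realType) (n : nat)
    (A : set 'rV[R]_n) (z zeta : 'rV[R]_n) :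
  (forall d, tangent_cone A z d -> enorm d = 1 -> dotp zeta d <= 0) ->
  regular_normal_cone A z zeta.
Proof.
move=> polar; apply/regular_normal_coneP => e e0; apply: contrapT => no_radius.
pose bad (r : R) := [set y | [/\ A y, enorm (y - z) < r &
  e * enorm (y - z) < dotp zeta (y - z)]].
have bad_neq0 r : 0 < r -> bad r !=set0.
  move=> r0; apply: contrapT => bad0; apply: no_radius; exists r => // y Ay yr.
  by rewrite leNgt; apply/negP => ylt; apply: bad0; exists y.
have bad_norm r y : bad r y -> 0 < enorm (y - z).
  move=> [_ _ ylt]; rewrite lt0r enorm_ge0 andbT; apply/eqP => yz.
  by move: ylt; rewrite (enorm_eq0 yz) enorm0 mulr0 dotp0r ltxx.
pose dir (y : 'rV[R]_n) := (enorm (y - z))^-1 *: (y - z).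
have dirE r y : bad r y -> z + enorm (y - z) *: dir y = y.
  move=> /bad_norm yz0; rewrite scalerA divff ?gt_eqF// scale1r.
  by rewrite addrC subrK.
have dir_unit r y : bad r y -> enorm (dir y) = 1.
  by move=> /bad_norm yz0; rewrite enormZ gtr0_norm ?invr_gt0// mulVf// gt_eqF.
have dir_gt r y : bad r y -> e < dotp zeta (dir y).
  move=> byr; have yz0 := bad_norm _ _ byr; case: byr => _ _ ylt.
  by rewrite dotpZr mulrC ltr_pdivlMr.
(* the filter of the directions of bad points approaching [z] *)
pose F := filter_from [set r : R | 0 < r] (fun r => dir @` bad r).
have F_filter : ProperFilter F.
  apply: filter_from_proper => [|r r0]; last first.
    by have [y by_] := bad_neq0 r r0; exists (dir y), y.
  apply: filter_from_filter; first by exists 1 => /=.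
  move=> r s r0 s0; exists (Num.min r s); first by rewrite /= lt_min r0.
  by move=> _ [y [Ay + ylt] <-]; rewrite lt_min => /andP[yr ys]; split; exists y.
have [d [d1 dF]] : [set u : 'rV[R]_n | enorm u = 1] `&` cluster F !=set0.
  apply: compact_unit_sphere; exists 1 => [/=//|_ [y by_ <-]].
  exact: dir_unit by_.
have : forall k : nat, exists y,
    bad k.+1%:R^-1 y /\ enorm (dir y - d) < k.+1%:R^-1.
  move=> k; have k0 : 0 < k.+1%:R^-1 :> R by rewrite invr_gt0.
  have [||_ [[y by_ <-] yd]] := dF (dir @` bad k.+1%:R^-1)
    [set u | enorm (u - d) < k.+1%:R^-1].
  - by exists k.+1%:R^-1.
  - exact: near_enorm.
  by exists y.
move=> /choice[y_ y_P].
have invS_small (s : R) : 0 < s -> \forall k \near \oo, k.+1%:R^-1 < s.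
  move=> s0; near=> k; near: k; exact: near_infty_natSinv_lt (PosNum s0).
have y_z : enorm (y_ k - z) @[k --> \oo] --> (0 : R).
  apply/cvgrPdist_lt => s s0; near=> k.
  rewrite sub0r normrN ger0_norm ?enorm_ge0//.
  have [[_ + _] _] := y_P k; move=> /lt_trans; apply.
  by near: k; exact: invS_small.
have dir_d : dir (y_ k) @[k --> \oo] --> d.
  apply/cvg_enormP => s s0; near=> k.
  have [_ +] := y_P k; move=> /lt_trans; apply.
  by near: k; exact: invS_small.
have : dotp zeta d <= 0.
  apply: polar => //; exists (fun k => enorm (y_ k - z)), (fun k => dir (y_ k)).
  split=> // k; have [yk _] := y_P k; first exact: bad_norm yk.
  by rewrite (dirE _ _ yk); case: yk.
apply/negP; rewrite -ltNge; apply: lt_le_trans e0 _.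
have e_cvg : (fun=> e) @ \oo --> e by exact: cvg_cst.
apply: (ler_cvg_to e_cvg (cvg_dotp dir_d)).
by near=> k; have [yk _] := y_P k; exact: ltW (dir_gt _ _ yk).
Unshelve. all: by end_near. Qed.

(** The only limit multiplier available is [lb], so an inner calm direction [d]
lifts to a sequence in the graph that approaches [row_mx zb lb] at the same rate
in both components; a normal of the form [row_mx b 0] then sees only the first
component, and dividing by the rate gives [dotp b d <= 0]. *)
Lemma graph_normal_dom_normal (R : realType) (n m : nat)
    (K : 'rV[R]_n -> set 'rV[R]_m) (zb b : 'rV[R]_n) (lb : 'rV[R]_m) :
  closed (gph K) -> fuzzy_inner_calm_star_dom K zb -> K zb = [set lb] ->
  regular_normal_cone (gph K) (row_mx zb lb) (row_mx b 0) ->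
  regular_normal_cone (dom K) zb b.
Proof.
move=> K_closed calm Kzb /regular_normal_coneP normal.
apply: polar_tangent_sub_regular_normal => d dT d1.
have [kappa [lt [t [d_ [l_ [k0 [[t0 tcvg dcvg lcvg] hK]]]]]]] := calm d dT d1.
have zcvg : zb + t k *: d_ k @[k --> \oo] --> zb.
  rewrite -[X in _ --> X]addr0 -(scale0r d); apply: cvgD; first exact: cvg_cst.
  exact: cvgZ.
have ltE : lt = lb.
  have : gph K (row_mx zb lt).
    apply: (closed_cvg _ K_closed _ _ (cvg_row_mx zcvg lcvg)).
    by near=> k; rewrite /gph /= row_mxKl row_mxKr; case: (hK k).
  by rewrite /gph /= row_mxKl row_mxKr Kzb.
(* [dotp b d <= e * enorm d] for every [e]; along the sequence, the distance in
   the graph is at most [(1 + kappa) * t k * enorm (d_ k)], whence [e1]. *)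
rewrite ltE in lcvg hK; apply/ler_addgt0Pr => e e0; rewrite add0r.
pose e1 := e / (1 + kappa); have e10 : 0 < e1 by rewrite divr_gt0 ?addr_gt0.
have [r r0 rP] := normal e1 e10.
have e1k : e1 * (1 + kappa) = e by rewrite /e1 divfK// gt_eqF ?addr_gt0.
have -> : e = e * enorm d by rewrite d1 mulr1.
apply: (ler_cvg_to (cvg_dotp dcvg) (cvgMl_tmp (a := e) (cvg_enorm dcvg))).
have /cvg_enormP/(_ r r0) near_p := cvg_row_mx zcvg lcvg.
near=> k; have [Kk lk] := hK k.
have /rP : gph K (row_mx (zb + t k *: d_ k) (l_ k)).
  by rewrite /gph /= row_mxKl row_mxKr.
have pr : enorm (row_mx (zb + t k *: d_ k) (l_ k) - row_mx zb lb) < r by near: k.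
move=> /(_ pr); rewrite sub_row_mx addrAC subrr add0r dotp_row_mx dotp0l addr0.
rewrite dotpZr => main; have := enorm_row_mx_le (t k *: d_ k) (l_ k - lb).
rewrite enormZ (gtr0_norm (t0 k)) => le2.
rewrite -(ler_pM2l (t0 k)); apply: le_trans main _.
apply: le_trans (ler_wpM2l (ltW e10) (le_trans le2 (lerD (lexx _) lk))) _.
by rewrite -e1k le_eqVlt; apply/orP; left; apply/eqP; ring.
Unshelve. all: by end_near. Qed.

Unset Implicit Arguments.
Set Strict Implicit.

(** * The subdifferential inclusion *)

Theorem proposition4p21 (R : realType) (n m : nat)
    (M : set 'rV[R]_n) (K : 'rV[R]_n -> set 'rV[R]_m)
    (zb : 'rV[R]_n) (lb : 'rV[R]_m)
    (M_closed : closed M)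
    (K_closed : closed (gph K))
    (zb_in : (M `&` dom K) zb)
    (K_semicompact : inner_semicompact_dom K zb)
    (K_calm : fuzzy_inner_calm_star_dom K zb)
    (K_singleton : K zb = [set lb])
    (subdiff_incl : exists2 kappa : R, 0 < kappa &
      regular_subdiff (dist (prodset M [set: 'rV[R]_m] `&` gph K)) (row_mx zb lb)
      `<=` scaleset kappa
        (addset (prodset (regular_subdiff (dist M) zb) [set (0 : 'rV[R]_m)])
                (regular_subdiff (dist (gph K)) (row_mx zb lb)))) :
  exists2 kappa' : R, 0 < kappa' &
    regular_subdiff (dist (M `&` dom K)) zb
    `<=` scaleset kappa'
      (addset (regular_subdiff (dist M) zb) (regular_subdiff (dist (dom K)) zb)).
Proof.
have [Mzb [_ _]] := zb_in; have Kzb : K zb lb by rewrite K_singleton.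
have gph_zb : gph K (row_mx zb lb) by rewrite /gph /= row_mxKl row_mxKr.
have joint_zb : (prodset M [set: 'rV[R]_m] `&` gph K) (row_mx zb lb).
  by split=> //; split=> //; rewrite row_mxKl.
have dom_zb : dom K zb by exists lb.
have [kappa kappa0 incl] := subdiff_incl; exists kappa => // zeta.
rewrite !regular_subdiff_dist// => -[/regular_normal_coneP normal zeta1].
have : regular_subdiff (dist (prodset M [set: 'rV[R]_m] `&` gph K))
    (row_mx zb lb) (row_mx zeta 0).
  rewrite regular_subdiff_dist//; split; last by rewrite /= enorm_row_mx0.
  apply/regular_normal_coneP => e e0; have [r r0 rP] := normal e e0.
  exists r => // p; rewrite -(hsubmxK p) sub_row_mx dotp_row_mx dotp0l addr0.
  move=> [[+ _] Kp]; rewrite row_mxKl => Mp pr.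
  have le_p := enorm_le_row_mx (lsubmx p - zb) (rsubmx p - lb).
  apply: le_trans (rP _ _ (le_lt_trans le_p pr)) (ler_wpM2l (ltW e0) le_p).
  by split=> //; exists (rsubmx p); move: Kp; rewrite /gph /= row_mxKl row_mxKr.
move=> /incl[_ [a [a_M a0] [q q_gph <-]]].
move: q_gph; rewrite regular_subdiff_dist// => -[q_normal q1].
rewrite -(hsubmxK a) -(hsubmxK q) a0 add_row_mx add0r scale_row_mx.
move=> /eq_row_mx[zetaE /eqP]; rewrite scaler_eq0 gt_eqF//= => /eqP qr0.
move: q_normal q1; rewrite -(hsubmxK q) qr0 /= enorm_row_mx0 => q_normal q1.
rewrite -zetaE; eexists; last by [].
exists (lsubmx a); first by rewrite -regular_subdiff_dist.
exists (lsubmx q) => //; split=> //.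
exact: (graph_normal_dom_normal K_closed K_calm K_singleton).
Qed.
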